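(* For every $\theta\in\mathbb N^{\mathbb N}$, $(K,T[\theta])$ is an arc cyclic, prime topological tournament and $K$ is a Cantor set. Moreover, if $\theta\ne\theta'$ in $\mathbb N^{\mathbb N}$, then $(K,T[\theta])$ and $(K,T[\theta'])$ are not isomorphic.
   Context: $\mathbb N=\{1,2,\dots\}$. A tournament on a nonempty set $X$ is a relation $R\subset X\times X$ with $R\cap R^{-1}=1_X$ (the diagonal) and $R\cup R^{-1}=X\times X$; $R^\circ=R\setminus1_X$; write $x\rightharpoonup y$ for $(x,y)\in R^\circ$. It is topological if $R$ is closed in $X\times X$ and nontrivial if $|X|>1$. It is arc cyclic if every arc $(x_1,x_2)\in R^\circ$ is contained in a 3-cycle $x_1\rightharpoonup x_2\rightharpoonup x_3\rightharpoonup x_1$. A quotient map $h:(X_2,R_2)\to(X_1,R_1)$ of compact topological tournaments is a continuous surjection with $(h\times h)(R_2)\subset R_1$; it is an isomorphism if injective. A nontrivial compact topological tournament is prime if its only quotient maps onto nontrivial tournaments are isomorphisms. $\mathbb Z[2]$ is the topological group of 2-adic integers, written as $\{0,1\}^{\mathbb N}$ with addition coordinatewise mod 2 with carrying to the right. For $i\in\mathbb N$, $A_i=\{0^{i-1}10z:z\in\mathbb Z[2]\}$; $A=\{0\}\cup\bigcup_iA_i$; and $\widehat A=\{(x,y):y-x\in A\}$, a topological tournament on $\mathbb Z[2]$. Let $2\mathbb N^*$ be the one-point compactification, by a point $\infty$, of the discrete set $\mathbb N\times\{-1,+1\}$, whose points are written $i-=(i,-1)$, $i+=(i,+1)$. The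 tournament $2L_1$ on $2\mathbb N^*$ is given by: $(i+1)+\rightharpoonup i+$ and $i+\rightharpoonup j+$ if $i+1<j$; $i-\rightharpoonup(i+1)-$ and $j-\rightharpoonup i-$ if $i+1<j$; $i+\rightharpoonup\infty$ and $\infty\rightharpoonup i-$ for all $i$; $i-\rightharpoonup i+$ for all $i$; $i+\rightharpoonup j-$ for all $j\neq i$. $K$ is the one-point compactification, by a point $\infty$, of $(\mathbb N\times\{-1,+1\})\times\mathbb Z[2]$ (with $\mathbb N\times\{-1,+1\}$ discrete). For $\theta\in\mathbb N^{\mathbb N}$, the tournament $T[\theta]$ on $K$ is defined as follows, for $a,b\in\mathbb N\times\{-1,+1\}$ and $x,y\in\mathbb Z[2]$: (1) on $\{a\}\times\mathbb Z[2]$ it is $\widehat A$: $((a,x),(a,y))\in T[\theta]$ iff $(x,y)\in\widehat A$; (2) if $a\ne b$ and $\{a,b\}$ is not of the form $\{i-,i+\}$, then $(a,x)\rightharpoonup(b,y)$ iff $a\rightharpoonup b$ in $2L_1$; (3) $(i+,x)\rightharpoonup\infty$ and $\infty\rightharpoonup(i-,x)$ for all $i$ and $x$; (4) for $i\in\mathbb N$ with $j=\theta_i$: $(i-,x)\rightharpoonup(i+,y)$ if the $j$-th coordinates satisfy $x_j=y_j$, and $(i+,y)\rightharpoonup(i-,x)$ if $x_j\ne y_j$. *)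

(* Defs.v *)
From HB Require Import structures.
From mathcomp Require Import all_boot all_algebra.
From mathcomp Require Import all_classical.
From mathcomp Require Import topology cantor.

Set Implicit Arguments.
Unset Strict Implicit.
Unset Printing Implicit Defensive.

Import GRing.Theory.
Local Open Scope classical_set_scope.
Local Open Scope ring_scope.

Section tournaments.
Implicit Types X Y : topologicalType.

Definition tournament (X : Type) (R : set (X * X)) : Prop :=
  [/\ [set: X] !=set0, R `&` R^-1%relation = diagonal &
      R `|` R^-1%relation = [set: X * X]].

Definition arc (X : Type) (R : set (X * X)) (x y : X) : Prop :=
  (R `\` diagonal) (x, y).

Definition nontrivial (X : Type) : Prop := exists x y : X, x <> y.

Definition arc_cyclic (X : Type) (R : set (X * X)) : Prop :=
  forall x1 x2 : X, arc R x1 x2 -> exists x3 : X, arc R x2 x3 /\ arc R x3 x1.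

(* The diagonal of a topological tournament is closed, so the underlying space
   is Hausdorff; this is why no separation axiom is imposed below. *)
Definition topological_tournament X (R : set (X * X)) : Prop :=
  tournament R /\ closed R.

Definition compact_tournament X (R : set (X * X)) : Prop :=
  topological_tournament R /\ compact [set: X].

Definition quotient_map X Y (R : set (X * X)) (S : set (Y * Y)) (h : X -> Y) :
    Prop :=
  [/\ continuous h, range h = [set: Y] &
      [set (h p.1, h p.2) | p in R] `<=` S].

Definition tournament_iso X Y (R : set (X * X)) (S : set (Y * Y)) (h : X -> Y) :
    Prop :=
  quotient_map R S h /\ injective h.

Definition isomorphic X Y (R : set (X * X)) (S : set (Y * Y)) : Prop :=
  exists h : X -> Y, tournament_iso R S h.

Definition prime_tournament X (R : set (X * X)) : Prop :=
  [/\ compact_tournament R, nontrivial X &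
      forall (Y : topologicalType) (S : set (Y * Y)) (h : X -> Y),
        compact_tournament S -> nontrivial Y -> quotient_map R S h ->
        tournament_iso R S h].

End tournaments.

(* [cantor_like] does not entail metrizability, hence is not used here. *)
Definition cantor_set (X : topologicalType) : Prop :=
  exists (f : cantor_space -> X) (g : X -> cantor_space),
    [/\ cancel f g, cancel g f, continuous f & continuous g].

(* Throughout, the positive integers 1, 2, 3, ... are represented by the
   elements 0, 1, 2, ... of [nat]; this applies to the coordinates of a 2-adic
   integer, to the indices of the points i-, i+ and to the indices and the
   values of a sequence theta. *)

Definition Z2adic : Type := cantor_space.

HB.instance Definition _ := Topological.on Z2adic.

Section Z2adic_group.
Implicit Types x y z : Z2adic.

(* [carry x y n] is the carry into coordinate [n] when [x] and [y] are added. *)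
Fixpoint carry x y (n : nat) : bool :=
  if n is m.+1 then
    [|| x m && y m, x m && carry x y m | y m && carry x y m]
  else false.

Definition Z2adic_zero : Z2adic := fun=> false.

Definition Z2adic_add x y : Z2adic := fun n => x n (+) y n (+) carry x y n.

(* Two's complement: flip every coordinate after the first nonzero one. *)
Definition Z2adic_opp x : Z2adic := fun n => x n (+) has x (iota 0 n).

Lemma Z2adic_addC : commutative Z2adic_add.
Proof.
have cC x y n : carry x y n = carry y x n.
  elim: n => //= n ->; case: (x n); case: (y n); by case: (carry y x n).
move=> x y; apply/funext => n; rewrite /Z2adic_add cC.
by case: (x n); case: (y n).
Qed.

Lemma Z2adic_addA : associative Z2adic_add.
Proof.
move=> x y z.
have H n : (carry y z n + carry x (Z2adic_add y z) n =
            carry x y n + carry (Z2adic_add x y) z n)%N.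
  elim: n => //= n; rewrite /Z2adic_add -/(Z2adic_add y z) -/(Z2adic_add x y).
  case: (x n); case: (y n); case: (z n); case: (carry y z n);
  case: (carry x y n); case: (carry x (Z2adic_add y z) n);
  by case: (carry (Z2adic_add x y) z n).
apply/funext => n; move: (H n); rewrite {1 3}/Z2adic_add.
rewrite [in X in _ -> X = _]/Z2adic_add [in X in _ -> _ = X]/Z2adic_add.
rewrite -/(Z2adic_add y z) -/(Z2adic_add x y).
case: (x n); case: (y n); case: (z n); case: (carry y z n);
case: (carry x y n); case: (carry x (Z2adic_add y z) n);
by case: (carry (Z2adic_add x y) z n).
Qed.

Lemma Z2adic_add0 : left_id Z2adic_zero Z2adic_add.
Proof.
move=> x; apply/funext => n; rewrite /Z2adic_add.
suff -> : carry Z2adic_zero x n = false by rewrite addbF.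
by elim: n => //= n ->; rewrite andbF.
Qed.

Lemma Z2adic_addN : left_inverse Z2adic_zero Z2adic_opp Z2adic_add.
Proof.
move=> x; apply/funext => n; rewrite /Z2adic_add.
suff -> : carry (Z2adic_opp x) x n = has x (iota 0 n).
  by rewrite /Z2adic_opp; case: (x n); case: (has _ _).
elim: n => // n IH; rewrite -addn1 iotaD has_cat addn1 /= IH orbF add0n.
by rewrite /Z2adic_opp; case: (x n); case: (has _ _).
Qed.

End Z2adic_group.

HB.instance Definition _ := GRing.isZmodule.Build Z2adic
  Z2adic_addA Z2adic_addC Z2adic_add0 Z2adic_addN.

(* The 2-adic integers of the form 0^i 1 0 z, with [i] zeros in front. *)
Definition A_ (i : nat) : set Z2adic :=
  [set x | [/\ forall k, (k < i)%N -> x k = false,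
               x i = true & x i.+1 = false]].

Definition A : set Z2adic := [set 0] `|` \bigcup_i A_ i.

Definition Ahat : set (Z2adic * Z2adic) := [set p | A (p.2 - p.1)].

(* The point i+ is [(i, true)] and the point i- is [(i, false)]. *)
Definition signed_nat : Type := discrete_topology (nat * bool)%type.

HB.instance Definition _ := DiscreteTopology.on signed_nat.

Definition twoN_infty : Type := one_point_compactification signed_nat.

HB.instance Definition _ := Topological.on twoN_infty.

(* The diagonal together with the listed arcs; [None] is the point at
   infinity. *)
Definition twoL1 : set (twoN_infty * twoN_infty) := [set p |
  match p.1, p.2 with
  | Some (i, true), Some (j, true) => [\/ i = j, i = j.+1 | (i.+1 < j)%N]
  | Some (i, false), Some (j, false) => [\/ i = j, j = i.+1 | (j.+1 < i)%N]
  | Some (i, false), Some (j, true) => i = j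
  | Some (i, true), Some (j, false) => i <> j
  | Some (_, s), None => s = true
  | None, Some (_, s) => s = false
  | None, None => True
  end].

Definition K : Type := one_point_compactification (signed_nat * Z2adic)%type.

HB.instance Definition _ := Topological.on K.

Definition T_ (theta : nat -> nat) : set (K * K) := [set p |
  match p.1, p.2 with
  | Some ((i, s) as a, x), Some ((j, t) as b, y) =>
      if a == b then Ahat (x, y)
      else if i == j then
        (* {a, b} = {i-, i+} *)
        if t then x (theta i) = y (theta i) else x (theta i) <> y (theta i)
      else arc twoL1 (Some a) (Some b)
  | Some ((_, s), _), None => s = true
  | None, Some ((_, s), _) => s = false
  | None, None => True
  end].

(* Main.v *)
Require Import Defs.
From mathcomp Require Import all_boot all_algebra all_classical topology cantor.
From mathcomp Require Import zify.

(** The combinatorial part rests on a description of the tournament on the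
    2-adic integers by bits: if [n] is the first index at which [x] and [y]
    differ, then the arc goes from [x] to [y] exactly when
    [y n.+1 = x n.+1 (+) x n] (lemma [AhatE]).

    Primality.  The fibres of a quotient map between tournaments are convex: a
    vertex that lies between two vertices of a fibre, in the sense of
    [convex_in], belongs to the fibre.  So it is enough that a convex set with
    two vertices is everything.  Inside one copy of the 2-adic integers this is
    [convex_full].  In [K], if a convex set contains both ends of an arc which
    is not inside one copy, the third vertices of the 3-cycles through this arc
    belong to the set, and this provides two vertices of the set in one copy
    ([convex_meets_fibre_twice]).  Hence the set contains a whole copy, and from
    there it spreads over [K] ([convex_all]).

    Non-isomorphism.  The copies indexed by the points i- are arranged as in the
    tournament [L1] on the natural numbers, where i beats i+1 and is beaten by
    every j > i+1.  This tournament has no automorphism but the identity, and its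
    convex sets are trivial, so that in a lexicographic sum over [L1] the level of
    a vertex is an isomorphism invariant ([lexL1_rigid]).  Such sums occur twice: the vertices beaten by
    infinity form one, with the index i of i- as level, and so do the 2-adic
    integers beaten by a given [x], with the first index at which they differ
    from [x] as level.  The point at infinity can be recognized by the 3-cycles
    through it ([cycles_complete]).  Therefore an isomorphism fixes infinity,
    maps every copy i- to itself, and preserves there the first index at which
    two points differ.  Moreover two points of i- have the same bit at [theta i]
    exactly when some vertex which beats infinity is beaten by both of them, so
    the isomorphism carries the relation of having the same bit at [theta i] to
    that of having the same bit at [theta' i].  If [theta' i < theta i], two
    points that first differ at [theta i] contradict this ([iso_theta_le]); the
    other inequality follows from the inverse isomorphism.

    Topology.  The ends of an arc have neighbourhoods between which all arcs
    have the same direction ([edge_open]); so the tournament is closed.  A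
    homeomorphism to the Cantor space sends infinity to the zero sequence and
    a point [x] of the m-th copy to m zeros, a one, and then [x]. *)

Set Implicit Arguments.
Unset Strict Implicit.
Unset Printing Implicit Defensive.

Local Open Scope classical_set_scope.

(** * Lexicographic sums over a rigid tournament *)

(** The tournament which 2L1 induces on the points i-, without the diagonal; on
    the points i+ it induces the reverse. *)
Definition L1 (i j : nat) : bool := (j == i.+1) || (j.+1 < i).

Lemma L1_total i j : i <> j -> L1 i j = ~~ L1 j i.
Proof. rewrite /L1; lia. Qed.

Lemma L1_asym i j : L1 i j -> L1 j i -> False.
Proof. rewrite /L1; lia. Qed.

Lemma L1_ltn i j : i < j -> L1 i j = (j == i.+1).
Proof. rewrite /L1; lia. Qed.

(** The number 0 beats 1 alone and 1 beats 2 alone, while every other number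
    beats at least two numbers; so 0 is fixed, as it cannot be mapped to 1 with 1
    mapped to 2.  Once the numbers up to n are fixed, n+1 is mapped to a number
    greater than n which n beats, and only n+1 is one. *)
Lemma L1_rigid (f : nat -> nat) :
  injective f -> (forall m, exists n, f n = m) ->
  (forall i j, i <> j -> L1 (f i) (f j) = L1 i j) -> f =1 id.
Proof.
move=> finj fsurj fL1.
have f_succ n : f n.+1 = (f n).+1 \/ (f n.+1).+1 < f n.
  have : L1 (f n) (f n.+1) by rewrite fL1 ?/L1 ?eqxx; lia.
  by case/orP => [/eqP|]; [left|right].
have out0 m : L1 (f 0) m -> m = f 1.
  have [k <-] := fsurj m; have [->|k0] := eqVneq k 0; first by rewrite /L1; lia.
  by rewrite fL1; [rewrite /L1 orbF => /eqP ->|move/eqP: k0; lia].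
have out1 m : L1 (f 1) m -> m = f 2.
  have [k <-] := fsurj m; have [->|k1] := eqVneq k 1; first by rewrite /L1; lia.
  rewrite fL1; last by move/eqP: k1; lia.
  by rewrite /L1 => k12; congr f; move/eqP: k1; lia.
have f0 : f 0 = 0.
  have [//|m_gt0] := posnP (f 0).
  have f1 : f 1 = (f 0).+1 by rewrite -(out0 (f 0).+1)// /L1 eqxx.
  have [f0_gt1|] := ltnP 1 (f 0).
    by have := out0 0; rewrite /L1 f0_gt1 orbT f1 => /(_ isT).
  move=> f0_le1; have {}f0_le1 : f 0 = 1 by lia.
  have := out1 0; have := out1 3; rewrite f1 f0_le1 /L1 /=.
  by move=> /(_ isT) <- /(_ isT).
move=> n; elim/ltn_ind: n => -[//|n] IH.
have := f_succ n; rewrite (IH n)// => -[//|f_lt].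
have ffn : f (f n.+1) = f n.+1 by apply: IH; lia.
by have := finj _ _ ffn; lia.
Qed.

Definition convex_in X (D : set X) (r : X -> X -> Prop) (M : set X) :=
  forall x y z, M x -> M y -> D z -> r x z -> r z y -> M z.

(** The tournament [r] on [D] is a lexicographic sum over [L1], with nonempty
    summands the level sets of [lev]. *)
Definition lexL1 X (D : set X) (r : X -> X -> Prop) (lev : X -> nat) :=
  (forall n, exists2 x, D x & lev x = n) /\
  (forall x y, D x -> D y -> lev x <> lev y -> (r x y <-> L1 (lev x) (lev y))).

(** Level k+1 lies between the levels i and k if k > i+1, and the levels n+2 and
    n-1 lie between n and n+1; so a convex set that meets two levels meets all of
    them, and then it contains each level n, because that level lies between n+2
    and n+1. *)
Lemma lexL1_convex X (D : set X) r lev (M : set X) x y :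
  lexL1 D r lev -> convex_in D r M -> M `<=` D ->
  M x -> M y -> lev x <> lev y -> D `<=` M.
Proof.
move=> [lev_surj levE] cM MD.
pose meets n := exists2 z, M z & lev z = n.
have between k n m : meets k -> meets m -> k <> n -> n <> m ->
    L1 k n -> L1 n m -> forall z, D z -> lev z = n -> M z.
  move=> [a Ma <-] [b Mb <-] kn nm ka kb z Dz zn; apply: (cM a b) => //.
    by apply/levE; rewrite ?zn//; exact: MD.
  by apply/levE; rewrite ?zn//; exact: MD.
have meetsI n : (forall z, D z -> lev z = n -> M z) -> meets n.
  by move=> H; have [z Dz zn] := lev_surj n; exists z => //; exact: H.
have consecutive i k : meets i -> meets k -> i < k ->
    exists n, meets n /\ meets n.+1.
  move=> mi mk ik; have [ik1|ki] := eqVneq i.+1 k.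
    by exists i; rewrite ik1.
  exists k; split => //; apply: meetsI.
  by apply: (between k _ i) => //; rewrite /L1; lia.
have up n : meets n -> meets n.+1 -> meets n.+2.
  move=> m0 m1; apply: meetsI.
  by apply: (between n.+1 _ n) => //; rewrite /L1; lia.
have down n : meets n.+1 -> meets n.+2 -> forall z, D z -> lev z = n -> M z.
  by move=> m1 m2; apply: (between n.+2 _ n.+1) => //; rewrite /L1; lia.
move=> Mx My xy.
have [n [m0 m1]] : exists n, meets n /\ meets n.+1.
  have mx : meets (lev x) by exists x.
  have my : meets (lev y) by exists y.
  by have [||//] := ltngtP (lev x) (lev y); exact: consecutive.
have all_up k : meets (n + k) /\ meets (n + k).+1.
  by elim: k => [|k [IH1 IH2]]; rewrite ?addn0// addnS; split => //; exact: up.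
have all_down k : meets (n - k) /\ meets (n - k).+1.
  elim: k => [|k [IH1 IH2]]; rewrite ?subn0//.
  have [nk|kn] := leqP n k.
    by rewrite subnS; move: IH1 IH2; rewrite (eqP nk).
  have -> : (n - k.+1).+1 = n - k by lia.
  split => //; apply: meetsI; apply: down.
    by rewrite (_ : _.+1 = n - k)//; lia.
  by rewrite (_ : _.+2 = (n - k).+1)//; lia.
have all_meets k : meets k.
  have [nk|kn] := leqP n k.
    by have [+ _] := all_up (k - n); rewrite subnKC.
  by have [+ _] := all_down (n - k); rewrite subKn// ltnW.
by move=> z Dz; exact: (down (lev z)).
Qed.

(** The level sets of the target are convex, hence so are their preimages, and a
    preimage that met two levels would be everything. *)
Lemma lexL1_fibre X X' (D : set X) (D' : set X') r r' lev lev' f g x y :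
  lexL1 D r lev -> lexL1 D' r' lev' ->
  (forall x, D x -> D' (f x)) ->
  (forall y, D' y -> D (g y) /\ f (g y) = y) ->
  (forall x y, D x -> D y -> r x y -> r' (f x) (f y)) ->
  D x -> D y -> lev' (f x) = lev' (f y) -> lev x = lev y.
Proof.
move=> lexD [lev'_surj lev'E] fD gD fr Dx Dy fxy.
have [//|/eqP xy] := eqVneq (lev x) (lev y); exfalso.
pose M : set X := [set z | D z /\ lev' (f z) = lev' (f x)].
have cM : convex_in D r M.
  move=> a b z [Da fa] [Db fb] Dz az zb; split => //.
  apply: contrapT => fzx; apply: (@L1_asym (lev' (f z)) (lev' (f x))).
    by rewrite -{1}fb; apply/lev'E; rewrite ?fb; auto.
  by rewrite -{1}fa; apply/lev'E; rewrite ?fa; auto.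
have DM : D `<=` M by apply: (lexL1_convex lexD cM _ _ _ xy) => // z [].
have [u D'u lu] := lev'_surj (lev' (f x)).+1.
have [Dgu fgu] := gD _ D'u.
by have [_] := DM _ Dgu; rewrite fgu lu => /esym/n_Sn.
Qed.

(** By [lexL1_fibre] in both directions, [f] maps level sets to level sets, and
    so induces an automorphism of [L1]. *)
Lemma lexL1_rigid X X' (D : set X) (D' : set X') r r' lev lev' f g :
  lexL1 D r lev -> lexL1 D' r' lev' ->
  (forall x, D x -> D' (f x) /\ g (f x) = x) ->
  (forall y, D' y -> D (g y) /\ f (g y) = y) ->
  (forall x y, D x -> D y -> r x y <-> r' (f x) (f y)) ->
  forall x, D x -> lev' (f x) = lev x.
Proof.
move=> lexD lexD' fD gD fr.
have fib x y : D x -> D y -> lev' (f x) = lev' (f y) <-> lev x = lev y.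
  move=> Dx Dy; split.
    apply: (@lexL1_fibre _ _ _ _ _ _ _ _ f g _ _ lexD lexD') => //.
      by move=> z /fD[].
    by move=> a b Da Db /fr; apply.
  move=> xy; apply: (@lexL1_fibre _ _ _ _ _ _ _ _ g f _ _ lexD' lexD).
  - by move=> z /gD[].
  - by [].
  - move=> a b Da Db; have [Dga {1}<-] := gD _ Da; have [Dgb {1}<-] := gD _ Db.
    by move/fr; apply.
  - by have [] := fD _ Dx.
  - by have [] := fD _ Dy.
  - by have [_ ->] := fD _ Dx; have [_ ->] := fD _ Dy.
case: (lexD) => lev_surj levE; case: (lexD') => lev'_surj lev'E.
pose s n := sval (cid2 (lev_surj n)).
have sP n : D (s n) /\ lev (s n) = n by rewrite /s; case: cid2.
have phiE x : D x -> lev' (f x) = lev' (f (s (lev x))).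
  by move=> Dx; apply/fib => //; [have [] := sP (lev x)|have [] := sP (lev x)].
suff phi1 : (fun n => lev' (f (s n))) =1 id by move=> x Dx; rewrite phiE// phi1.
apply: L1_rigid => [n m|m|i j ij].
- have [Dn ln] := sP n; have [Dm lm] := sP m.
  by move=> /fib; rewrite ln lm; apply.
- have [u D'u lu] := lev'_surj m; have [Du fu] := gD _ D'u.
  by exists (lev (g u)); rewrite -phiE// fu.
- have [Di li] := sP i; have [Dj lj] := sP j.
  have [D'i _] := fD _ Di; have [D'j _] := fD _ Dj.
  have ij' : lev' (f (s i)) <> lev' (f (s j)).
    by move=> /(fib _ _ Di Dj); rewrite li lj.
  apply/idP/idP => [Lij|Lij].
    rewrite -li -lj; apply/levE => //; first by rewrite li lj.
    by apply/fr => //; apply/lev'E.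
  apply/lev'E => //; apply/fr => //; apply/levE => //; by rewrite li lj.
Qed.

(** * The tournament on the 2-adic integers *)

Definition differ_at (x y : Z2adic) n :=
  (forall k, k < n -> x k = y k) /\ x n <> y n.

Lemma exists_differ_at x y : x <> y -> exists n, differ_at x y n.
Proof.
move=> xy; have ex : exists n, x n != y n.
  apply: contra_notP xy => nex; apply/funext => n.
  by apply/eqP; apply: contra_notT nex => xyn; exists n.
have /eqP xyn := xchooseP ex.
case: (ex_minnP ex) => n /eqP xn n_min; exists n; split => // k kn.
by apply/eqP; apply: contraTT kn => /n_min; rewrite -leqNgt.
Qed.

Lemma differ_at_neq x y n : differ_at x y n -> x <> y.
Proof. by move=> [_ xyn] xy; rewrite xy in xyn. Qed.

Lemma differ_at_inj x y m n : differ_at x y m -> differ_at x y n -> m = n.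
Proof.
move=> [xym dm] [xyn dn]; have [mn|nm|//] := ltngtP m n.
  by have := xyn _ mn.
by have := xym _ nm.
Qed.

Lemma differ_at_sym x y n : differ_at x y n -> differ_at y x n.
Proof. by move=> [xy dn]; split => [k /xy//|/esym]. Qed.

Lemma differ_at_ltn x y z m n :
  differ_at x y m -> differ_at x z n -> n < m -> differ_at y z n.
Proof.
move=> [xy _] [xz xzn] nm; split=> [k kn|]; last by rewrite -xy.
by rewrite -(xy _ (ltn_trans kn nm)) xz.
Qed.

Definition flip (x : Z2adic) n : Z2adic := fun k => x k (+) (k == n).

Lemma differ_at_flip x n : differ_at x (flip x n) n.
Proof.
split=> [k kn|]; rewrite /flip; first by rewrite (_ : k == n = false) ?addbF//; lia.
by rewrite eqxx; case: (x n).
Qed.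

Lemma flip_at x n : flip x n n = ~~ x n.
Proof. by rewrite /flip eqxx addbT. Qed.

Lemma flip_neq x n k : k <> n -> flip x n k = x k.
Proof. by move=> /eqP/negPf kn; rewrite /flip kn addbF. Qed.

Definition first_diff (x y : Z2adic) : nat :=
  if pselect (exists n, differ_at x y n) is left e then sval (cid e) else 0.

Lemma first_diffE x y n : differ_at x y n -> first_diff x y = n.
Proof.
move=> xyn; rewrite /first_diff; case: pselect => [e|]; last by case; exists n.
by case: cid => m /= /differ_at_inj; apply.
Qed.

Definition prec (x y : Z2adic) :=
  exists2 n, differ_at x y n & y n.+1 = x n.+1 (+) x n.

Lemma precE x y n : differ_at x y n -> prec x y <-> y n.+1 = x n.+1 (+) x n.
Proof.
by move=> xyn; split=> [[m xym]|]; [rewrite (differ_at_inj xyn xym)|exists n].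
Qed.

Lemma prec_irr x : ~ prec x x.
Proof. by move=> [n /differ_at_neq]. Qed.

Lemma prec_asym x y : prec x y -> prec y x -> False.
Proof.
move=> [n xyn E]; move: (xyn) => [_ xn].
move=> /(precE (differ_at_sym xyn)); rewrite E.
by case: (x n.+1); case: (x n) xn; case: (y n).
Qed.

Lemma prec_total x y : x <> y -> prec x y \/ prec y x.
Proof.
move=> /exists_differ_at[n xyn]; have [_ xn] := xyn.
rewrite (precE xyn) (precE (differ_at_sym xyn)).
by case: (x n.+1); case: (y n.+1); case: (x n) xn; case: (y n) => //; auto.
Qed.

Lemma carry_lowbits x z n : (forall k, k < n -> z k = false) ->
  carry x z n = false.
Proof.
elim: n => //= n IH z0; rewrite IH => [|k kn]; last by apply: z0; lia.
by rewrite z0// !andbF.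
Qed.

(** With [y = x + z], where [z] starts with n zeros and a one: the carry out of
    position n is [x n], so that [y n.+1] determines [z n.+1]. *)
Lemma AhatE x y : Ahat (x, y) <-> x = y \/ prec x y.
Proof.
rewrite /Ahat /A /=; set z := (y - x)%R.
have -> : y = Z2adic_add x z.
  by rewrite -[LHS](GRing.subrK x) GRing.addrC.
move: z => z {y}.
have low n k : (forall k, k < n -> z k = false) -> k <= n ->
    Z2adic_add x z k = x k (+) z k.
  move=> z0 kn; rewrite /Z2adic_add carry_lowbits ?addbF// => m mk.
  by apply: z0; exact: leq_trans mk kn.
have high n : (forall k, k < n -> z k = false) -> z n ->
    Z2adic_add x z n.+1 = x n.+1 (+) z n.+1 (+) x n.
  move=> z0 zn; rewrite /Z2adic_add /= carry_lowbits// zn andbT !andbF !orbF.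
  by [].
split=> [[z0|[n _ [z0 zn zn1]]]|[xz|[n [xz xzn] E]]].
- left; apply/funext => k; rewrite (low k k)//.
    by rewrite z0 addbF.
  by move=> m _; rewrite z0.
- right; exists n; last by rewrite high// zn1 addbF.
  split=> [k kn|]; rewrite (low n)// 1?ltnW//.
    by rewrite z0// addbF.
  by rewrite zn; case: (x n).
- left; apply/funext => k; elim/ltn_ind: k => k IH.
  by move/(congr1 (@^~ k)): xz; rewrite (low k)//; case: (x k); case: (z k).
- have z0 k : k < n -> z k = false.
    elim/ltn_ind: k => k IH kn; have := xz _ kn; rewrite (low k)//.
      by case: (x k); case: (z k).
    by move=> m mk; apply: IH => //; exact: ltn_trans mk kn.
  have zn : z n = true.
    by move: xzn; rewrite (low n)//; case: (x n); case: (z n).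
  right; exists n => //; split => //.
  by move: E; rewrite high//; case: (x n.+1); case: (z n.+1); case: (x n).
Qed.

(** As [w] first differs from [x] at n+1, it is beaten by [y] whatever its later
    bits are, and its bit at n+2 can be chosen so that it beats [x]. *)
Lemma prec_cycle x y n : differ_at x y n -> prec x y ->
  exists w, [/\ differ_at x w n.+1, prec y w & prec w x].
Proof.
move=> xyn /(precE xyn) yn1; have [xy dn] := xyn.
pose w : Z2adic := fun k => if k == n.+1 then ~~ x n.+1
  else if k == n.+2 then x n.+2 (+) ~~ x n.+1 else x k.
have wE1 : w n.+1 = ~~ x n.+1 by rewrite /w eqxx.
have wE2 : w n.+2 = x n.+2 (+) ~~ x n.+1.
  by rewrite /w eqxx; case: eqP => //; lia.
have wE k : k < n.+1 -> w k = x k.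
  by move=> kn; rewrite /w; case: eqP; [lia|case: eqP => //; lia].
have xwn : differ_at x w n.+1.
  by split=> [k kn|]; [rewrite wE|rewrite wE1; case: (x n.+1)].
exists w; split => //.
- apply/(precE (differ_at_sym (differ_at_ltn xwn xyn (ltnSn n)))).
  by move: dn; rewrite wE1 yn1; case: (x n.+1); case: (x n); case: (y n).
- by apply/(precE (differ_at_sym xwn)); rewrite wE1 wE2 -addbA addbb addbF.
Qed.

Section convex_subsets.
Variable M : set Z2adic.
Hypothesis cM : convex_in setT prec M.

(** Since [x] and [y] have different bits at n+1, one of them beats [z] and the
    other is beaten by it. *)
Lemma convex_coarser1 x y z n :
  M x -> M y -> differ_at x y n.+1 -> differ_at x z n -> M z.
Proof.
move=> Mx My xyn xzn; have yzn := differ_at_ltn xyn xzn (ltnSn n).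
have [xz_prec yz_prec] := (precE xzn, precE yzn).
have [xy dn] := xyn; have yn : y n = x n by rewrite xy.
have split_xy : prec x z <-> ~ prec y z.
  rewrite xz_prec yz_prec yn.
  by move: dn; case: (x n.+1); case: (y n.+1); case: (z n.+1); case: (x n).
have [xz|zx] := prec_total (differ_at_neq xzn).
  have [yz|zy] := prec_total (differ_at_neq yzn); last exact: (cM Mx My).
  by move/split_xy: xz.
have [yz|zy] := prec_total (differ_at_neq yzn); first exact: (cM My Mx).
by exfalso; apply: (prec_asym zx); apply/split_xy => /(prec_asym zy).
Qed.

Lemma convex_coarser x y z m n :
  M x -> M y -> differ_at x y n -> m < n -> differ_at x z m -> M z.
Proof.
move=> + + + + xzm; elim: n y => // n IH y Mx My xyn.
rewrite ltnS leq_eqVlt => /orP[/eqP mn|mn].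
  by subst m; exact: (convex_coarser1 Mx My xyn).
(* The pair of [x] and its flip first differs one index earlier. *)
have Mx' := convex_coarser1 Mx My xyn (differ_at_flip x n).
exact: (IH _ Mx Mx' (differ_at_flip x n)).
Qed.

(** By [convex_coarser], two points that first differ at n+1 put into [M] all
    points differing at 0 from the first of them.  Among these are pairs that
    first differ at an arbitrarily late index, to which [convex_coarser] applies
    again.  If the two given points differ at 0, a 3-cycle through them
    provides a pair that first differs at 1. *)
Lemma convex_full x y : M x -> M y -> x <> y -> M = setT.
Proof.
have posn a b n : M a -> M b -> differ_at a b n.+1 -> M = setT.
  move=> Ma Mb abn.
  have Mc c : differ_at a c 0 -> M c by exact: convex_coarser abn _.
  have a0 := differ_at_flip a 0; have Mz := Mc _ a0.
  rewrite -subTset => w _; have [-> //|/eqP zw] := eqVneq w (flip a 0).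
  have [m zwm] := exists_differ_at (nesym zw).
  have zz' := differ_at_flip (flip a 0) m.+1.
  apply: (convex_coarser Mz (Mc _ _) zz' (ltnSn m) zwm).
  exact/differ_at_sym/(differ_at_ltn zz' (differ_at_sym a0)).
move=> Mx My /[dup] /exists_differ_at[n xyn].
wlog xy : x y Mx My xyn / prec x y.
  move=> wl xy; have [/wl|/wl] := prec_total xy; first exact.
  by apply => //; [exact: differ_at_sym|exact: nesym].
have [w [xwn yw wx]] := prec_cycle xyn xy.
by move=> _; apply: (posn x w n) => //; exact: (cM My Mx).
Qed.

End convex_subsets.

Lemma prec_out_exists x n : exists2 y, prec x y & differ_at x y n.
Proof.
pose y : Z2adic := fun k => if k == n then ~~ x n else
  if k == n.+1 then x n.+1 (+) x n else x k.
have xyn : differ_at x y n.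
  split=> [k kn|]; last by rewrite /y eqxx; case: (x n).
  by rewrite /y; case: eqP => [|_]; [lia|case: eqP => //; lia].
by exists y => //; apply/(precE xyn); rewrite /y eqxx; case: eqP => //; lia.
Qed.

Lemma prec_in_exists x n : exists2 y, prec y x & differ_at x y n.
Proof.
have [z xz xzn] := prec_out_exists x n; exists (flip z n.+1).
  have xyn : differ_at (flip z n.+1) x n.
    exact: differ_at_ltn (differ_at_flip z n.+1) (differ_at_sym xzn) (ltnSn n).
  apply/(precE xyn); have [_ dn] := xzn; move/(precE xzn): xz => E.
  rewrite flip_at flip_neq; last exact: n_Sn.
  by move: dn; rewrite E; case: (x n.+1); case: (x n); case: (z n).
apply: differ_at_sym.
exact: differ_at_ltn (differ_at_flip z n.+1) (differ_at_sym xzn) (ltnSn n).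
Qed.

(** The level sets are the translates [x + A_ n]. *)
Lemma prec_lexL1 x : lexL1 [set y | prec x y] prec (first_diff x).
Proof.
split=> [n|y z].
  have [y xy xyn] := prec_out_exists x n.
  by exists y => //; exact: first_diffE.
move=> -[i xyi yi] [k xzk zk].
rewrite (first_diffE xyi) (first_diffE xzk) => ik.
have core i' k' (u v : Z2adic) :
    differ_at x u i' -> u i'.+1 = x i'.+1 (+) x i' ->
    differ_at x v k' -> v k'.+1 = x k'.+1 (+) x k' -> i' < k' ->
    (prec u v <-> L1 i' k') /\ differ_at u v i'.
  move=> xu ui xv vk ik'; have uv := differ_at_sym (differ_at_ltn xv xu ik').
  split => //; rewrite (precE uv) ui.
  have [xvk dv] := xv; have [_ du] := xu.
  rewrite L1_ltn//; have [ki|ki] := eqVneq k' i'.+1.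
    subst k'; move: dv du.
    by case: (x i'.+1); case: (v i'.+1); case: (x i'); case: (u i').
  rewrite -xvk; last by rewrite ltn_neqAle eq_sym ki.
  by move: du; case: (x i'.+1); case: (x i'); case: (u i').
have [ki|ki|//] := ltngtP i k; first by have [] := core _ _ _ _ xyi yi xzk zk ki.
have [zyL zyi] := core _ _ _ _ xzk zk xyi yi ki.
rewrite L1_total//; split=> [yz|/negP kiL].
  by apply/negP => /zyL /prec_asym; apply.
by have [//|/zyL] := prec_total (differ_at_neq (differ_at_sym zyi)).
Qed.

(** Between the vertices that [x] beats and those that beat [x] only
    neighbouring levels are joined by an arc closing a 3-cycle through [x]; equal
    levels are excluded, as there both directions occur. *)
Lemma prec_between x y z m n :
  prec x y -> prec z x -> differ_at x y m -> differ_at x z n -> m <> n ->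
  prec y z <-> n = m.+1 \/ m = n.+1.
Proof.
move=> + + xym xzn mn; rewrite (precE xym) (precE (differ_at_sym xzn)).
have [[xyE ym] [xzE zn]] := (xym, xzn).
have [mn_lt|nm_lt|//] := ltngtP m n.
  rewrite (precE (differ_at_sym (differ_at_ltn xzn xym mn_lt))) => -> _.
  have -> : (n = m.+1 \/ m = n.+1) <-> n = m.+1.
    by split=> [[//|mn1]|]; [move: mn_lt; rewrite mn1 ltnNge leqnSn|left].
  have [nm|nm] := eqVneq n m.+1.
    subst n; move: zn ym.
    by case: (x m.+1); case: (z m.+1); case: (x m); case: (y m).
  rewrite -xzE; last by rewrite ltn_neqAle eq_sym nm.
  split=> [|nm']; last by rewrite nm' eqxx in nm.
  by move: ym; case: (x m.+1); case: (x m); case: (y m).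
rewrite (precE (differ_at_ltn xym xzn nm_lt)) => _ xn1.
have -> : (n = m.+1 \/ m = n.+1) <-> m = n.+1.
  by split=> [[nm1|//]|]; [move: nm_lt; rewrite nm1 ltnNge leqnSn|right].
have yn : y n = x n by rewrite xyE.
have [nm|nm] := eqVneq m n.+1.
  subst m; move: xn1 ym zn; rewrite yn.
  by case: (x n.+1); case: (y n.+1); case: (z n.+1); case: (x n); case: (z n).
split=> [|nm']; last by rewrite nm' eqxx in nm.
have yn1 : y n.+1 = x n.+1 by rewrite xyE// ltn_neqAle eq_sym nm.
move: xn1 zn; rewrite yn yn1.
by case: (x n.+1); case: (z n.+1); case: (x n); case: (z n).
Qed.

(** * The arcs of the tournament on K *)

Definition pt (i : nat) (s : bool) (x : Z2adic) : K :=
  Some ((i, s) : signed_nat, x).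

Definition inftyK : K := None.

(** The arcs of [T_ theta] without the diagonal, in a form that computes. *)
Definition edge (theta : nat -> nat) (p q : K) : Prop :=
  match p, q with
  | Some ((i, s), x), Some ((j, t), y) =>
      if i == j then
        if s == t then prec x y
        else if t then x (theta i) = y (theta i) else x (theta i) <> y (theta i)
      else match s, t with
           | true, true => L1 j i
           | false, false => L1 i j
           | true, false => True
           | false, true => False
           end
  | Some ((_, s), _), None => s
  | None, Some ((_, s), _) => ~~ s
  | None, None => False
  end.

Lemma twoL1_arcE i s j t : i <> j ->
  Defs.arc twoL1 (Some ((i, s) : signed_nat)) (Some ((j, t) : signed_nat)) <->
  match s, t with
  | true, true => L1 j i
  | false, false => L1 i j
  | true, false => True
  | false, true => False
  end.
Proof.
move=> ij.
have nd :
    ~ diagonal (Some ((i, s) : signed_nat), Some ((j, t) : signed_nat)).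
  by move/diagonalP => -[].
have -> (P : set (twoN_infty * twoN_infty)) p q :
    ~ diagonal (p, q) -> Defs.arc P p q <-> P (p, q).
  by move=> pq; split=> [[]|].
- rewrite /twoL1 /L1; case: s nd; case: t => nd /=; split => //.
  + by case=> [/ij//|/eqP ->//|->]; rewrite orbT.
  + by case/orP => [/eqP|]; [constructor 2|constructor 3].
  + by case=> [/ij//|/eqP ->//|->]; rewrite orbT.
  + by case/orP => [/eqP|]; [constructor 2|constructor 3].
- exact: nd.
Qed.

Section edge.
Variable theta : nat -> nat.
Local Notation edge := (edge theta).

Lemma edge_irr p : ~ edge p p.
Proof. by case: p => [[[i s] x]|//] /=; rewrite !eqxx => /prec_irr. Qed.

Lemma edge_asym p q : edge p q -> edge q p -> False.
Proof.
case: p => [[[i s] x]|]; case: q => [[[j t] y]|] //=; last first.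
- by case: t.
- by case: s.
rewrite (eq_sym j) (eq_sym t); case: eqVneq => [<-|_].
  case: eqVneq => [_|]; first exact: prec_asym.
  by case: s; case: t => //= _ xy yx; [apply: xy|apply: yx].
by case: s; case: t => //; exact: L1_asym.
Qed.

Lemma edge_total p q : p <> q -> edge p q \/ edge q p.
Proof.
case: p => [[[i s] x]|]; case: q => [[[j t] y]|] //=; last first.
- by case: t; auto.
- by case: s; auto.
rewrite (eq_sym j) (eq_sym t); case: eqVneq => [<-|ij].
  case: eqVneq => [<- pq|]; first by apply: prec_total => xy; apply: pq; rewrite xy.
  have [xy|xy] := eqVneq (x (theta i)) (y (theta i)).
    by case: s; case: t => //= _ _; auto.
  by case: s; case: t => //= _ _; [left|right]; apply/eqP; rewrite // eq_sym.
move=> _; case: s; case: t; auto.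
  by rewrite (@L1_total i j); [case: (L1 j i); auto|exact/eqP].
by rewrite (@L1_total i j); [case: (L1 j i); auto|exact/eqP].
Qed.

Lemma T_E p q : T_ theta (p, q) <-> p = q \/ edge p q.
Proof.
rewrite /T_ /=; case: p => [[[i s] x]|]; case: q => [[[j t] y]|] /=; last first.
- by split=> // _; left.
- by case: t; split=> [|[]]//; right.
- by case: s; split=> [|[]]//; right.
have -> : ((i, s) : signed_nat) == (j, t) = (i == j) && (s == t) by [].
case: eqVneq => [<-|ij] /=; last first.
  rewrite twoL1_arcE; last exact/eqP.
  split=> [e|[[ij' _ _]|//]]; first by right.
  by rewrite ij' eqxx in ij.
case: eqVneq => [<-|st] /=.
  rewrite AhatE; split=> [[->|xy]|[[->]|xy]]; by auto.
by split=> [|[[st']|//]]; [right|rewrite st' eqxx in st].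
Qed.

Lemma T_tournament : tournament (T_ theta).
Proof.
split; first by exists None.
- rewrite eqEsubset; split=> [[p q] [/T_E pq /T_E qp]|[p _] /diagonalP /= <-].
    apply/diagonalP => /=; case: pq => // pq; case: qp => // qp.
    by have := edge_asym pq qp.
  by split; apply/T_E; left.
- rewrite -subTset => -[p q] _.
  have [->|/eqP pq] := eqVneq p q; first by left; apply/T_E; left.
  by have [e|e] := edge_total pq; [left|right]; apply/T_E; right.
Qed.

Lemma arcE p q : Defs.arc (T_ theta) p q <-> edge p q.
Proof.
split=> [[/T_E[->|//] /(_ _)[]]//|pq].
split; first by apply/T_E; right.
by move/diagonalP => /= E; apply: (@edge_irr p); rewrite {2}E.
Qed.

(** Outside a single copy the third vertex can be taken in the opposite copy of
    one of the two ends, or at infinity. *)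
Lemma T_arc_cyclic : arc_cyclic (T_ theta).
Proof.
suff H p q : edge p q -> exists r, edge q r /\ edge r p.
  by move=> p q /arcE/H[r [qr rp]]; exists r; split; apply/arcE.
case: p => [[[i s] x]|]; case: q => [[[j t] y]|] //=; last first.
- by case: t => // _; exists (pt j true y) => /=; rewrite !eqxx.
- by case: s => // _; exists (pt i false x) => /=; rewrite !eqxx.
case: eqVneq => [<-|ij]; last first.
  case: s; case: t => //.
  - by exists (pt i false x); rewrite /= !eqxx eq_sym (negPf ij).
  - move=> _; have [ij1|ji] := boolP (L1 j i).
      by exists (pt i false x); rewrite /= !eqxx eq_sym (negPf ij).
    exists (pt j true y); rewrite /= !eqxx eq_sym (negPf ij); split => //.
    by rewrite (@L1_total i j)//; exact/eqP.
  - by exists (pt j true y); rewrite /= !eqxx eq_sym (negPf ij).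
case: eqVneq => [<-|st].
  move=> /[dup] -[n xyn _] /(prec_cycle xyn)[w [_ yw wx]].
  by exists (pt i s w); rewrite /= !eqxx.
case: s st; case: t => // _ /=.
- move=> xy; have [z yz [_ yzn]] := prec_out_exists y (theta i).
  exists (pt i false z); rewrite /= !eqxx; split => //.
  by move: xy yzn; case: (x _); case: (y _); case: (z _).
- by exists inftyK.
Qed.

Section convex_subsets.
Variable M : set K.
Hypothesis cM : convex_in setT edge M.

Lemma convex_fibre i s x y : M (pt i s x) -> M (pt i s y) -> x <> y ->
  forall z, M (pt i s z).
Proof.
move=> Mx My xy z; pose N : set Z2adic := [set u | M (pt i s u)].
have cN : convex_in setT prec N.
  move=> a b c Na Nb _ ac cb.
  by apply: (cM Na Nb) => //=; rewrite !eqxx.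
have : setT z by []; rewrite -(convex_full cN Mx My xy).
by [].
Qed.

(** The third vertices of the 3-cycles through the arc lie in [M].  Those in the
    copy opposite to one of the ends are restricted by a single bit, so there
    are at least two.  For an arc from (i-, x) to (i+, y), the third
    vertex infinity leads to the arc from (i+, y) to infinity; for an arc from
    (i+, x) to (i-, y), there is a third vertex in the copy i- itself. *)
Lemma convex_meets_fibre_twice p q : M p -> M q -> edge p q ->
  exists i s x y, [/\ M (pt i s x), M (pt i s y) & x <> y].
Proof.
have two i s j z : (forall x, x j = z j -> M (pt i s x)) ->
    exists i s x y, [/\ M (pt i s x), M (pt i s y) & x <> y].
  move=> H; exists i, s, z, (flip z j.+1); split.
  - exact: H.
  - by apply: H; rewrite flip_neq//; exact: n_Sn.
  - exact: differ_at_neq (differ_at_flip _ _).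
have from_plus_infty i y : M (pt i true y) -> M inftyK ->
    exists i s x y, [/\ M (pt i s x), M (pt i s y) & x <> y].
  move=> My Minf; apply: (two i false (theta i) y) => x xy.
  by apply: (cM Minf My) => //=; rewrite !eqxx.
case: p => [[[i s] x]|]; case: q => [[[j t] y]|] Mp Mq //=; last first.
- case: t Mq => // My _; apply: (two j true (theta j) y) => z zy.
  by apply: (cM My Mp) => //=; rewrite !eqxx.
- by case: s Mp => // Mx _; exact: from_plus_infty Mx Mq.
case: eqVneq => [ij|ij]; last first.
  case: s Mp; case: t Mq => // Mq Mp.
  - move=> _; apply: (two i false (theta i) x) => z zx.
    by apply: (cM Mq Mp) => //=; rewrite ?eqxx// eq_sym (negPf ij).
  - move=> _; have [ji|ji] := boolP (L1 j i).
      apply: (two i false (theta i) x) => z zx.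
      by apply: (cM Mq Mp) => //=; rewrite ?eqxx// eq_sym (negPf ij).
    apply: (two j true (theta j) y) => z zx.
    apply: (cM Mq Mp) => //=; rewrite ?eqxx// eq_sym (negPf ij).
    by rewrite (@L1_total i j)//; exact/eqP.
  - move=> _; apply: (two j true (theta j) y) => z zy.
    by apply: (cM Mq Mp) => //=; rewrite ?eqxx// eq_sym (negPf ij).
subst j; case: eqVneq => [st|st].
  subst t => xy; exists i, s, x, y; split => // E.
  by move: xy; rewrite E => /prec_irr.
case: s st Mp; case: t Mq => // Mq' _ Mp'.
- move=> xy; exists i, false.
  have [z yz [_ yzn]] := prec_out_exists y (theta i).
  exists y, z; split => //; last by move=> yz'; rewrite yz' in yzn.
  apply: (cM Mq' Mp') => //=; rewrite !eqxx//.
  by move: xy yzn; case: (x _); case: (y _); case: (z _).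
- by move=> xy; apply: (from_plus_infty _ _ Mq'); exact: (cM Mq' Mp').
Qed.

(** Each point of i- beats one half of i+ and is beaten by the other half, and
    vice versa, so [M] contains both copies as soon as it contains one, and then
    it contains infinity.  A copy j- or j+ lies between i+ and i- whenever j
    beats i in [L1]; since i-1 and i+2 beat i, all copies are reached. *)
Lemma convex_all p q : M p -> M q -> p <> q -> M = setT.
Proof.
move=> Mp Mq pq.
have [i [s [x [y [Mx My xy]]]]] :
    exists i s x y, [/\ M (pt i s x), M (pt i s y) & x <> y].
  by have [|] := edge_total pq; exact: convex_meets_fibre_twice.
have {Mx My xy p q Mp Mq pq}Ms := convex_fibre Mx My xy.
pose full i := forall s x, M (pt i s x).
have full_i : full i.
  have flipN (z : Z2adic) j : flip z j j <> z j by rewrite flip_at; case: (z j).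
  case: s Ms => Ms [] z //.
    apply: (cM (Ms (flip z (theta i))) (Ms z)) => //=; rewrite !eqxx//.
  apply: (cM (Ms z) (Ms (flip z (theta i)))) => //=; rewrite !eqxx//.
  exact/nesym/flipN.
have Minf : M inftyK.
  by apply: (cM (full_i true x) (full_i false x)).
have step j k : full k -> L1 j k -> full j.
  move=> fk jk s' z; have kj : (k == j) = false.
    by apply/negP => /eqP kj; move: jk; rewrite kj /L1; lia.
  case: s'.
    by apply: (cM (fk true z) (fk false z)) => //=; rewrite ?kj// eq_sym kj.
  by apply: (cM (fk true z) (fk false z)) => //=; rewrite ?kj// eq_sym kj.
have down k : full k.+1 -> full k by move=> fk; apply: step fk _; rewrite /L1 eqxx.
have up k : full k -> full k.+1.
  by move=> fk; apply: down; apply: step fk _; rewrite /L1 ltnSn orbT.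
have full0 : full 0 by elim: i full_i {Ms} => // n IH /down.
have full_all k : full k by elim: k => // k; exact: up.
by rewrite -subTset => -[[[k s'] z]|] _ //; exact: full_all.
Qed.

End convex_subsets.

Lemma T_quotient_iso (Y : topologicalType) (S : set (Y * Y)) (h : K -> Y) :
  tournament S -> nontrivial Y -> quotient_map (T_ theta) S h ->
  tournament_iso (T_ theta) S h.
Proof.
move=> [_ Santi _] [y [y' yy']] qh; split => // p q hpq.
apply: contrapT => pq; case: qh => _ h_surj h_arc.
have hS a b : edge a b -> S (h a, h b).
  by move=> ab; apply: h_arc; exists (a, b) => //; apply/T_E; right.
pose M : set K := [set r | h r = h p].
have cM : convex_in setT edge M.
  move=> a b c ha hb _ /hS ac /hS cb.
  suff : diagonal (h a, h c) by move/diagonalP => /= ac'; rewrite /M /= -ac'.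
  by rewrite -Santi; split => //; rewrite /= (ha : h a = h p) -(hb : h b = h p).
have MT : M = setT by apply: (convex_all cM _ _ pq).
have hc z : z = h p.
  have : range h z by rewrite h_surj.
  by move=> [r _ <-]; have : M r by rewrite MT.
by apply: yy'; rewrite (hc y) (hc y').
Qed.

End edge.

(** * Isomorphisms *)

(** The bipartite graph whose edges are the arcs from vertices beaten by [p] to
    vertices beating [p], that is, the 3-cycles through [p], is a disjoint union
    of complete bipartite graphs. *)
Definition cycles_complete (r : K -> K -> Prop) (p : K) :=
  forall q q' s s', r p q -> r p q' -> r s p -> r s' p ->
    r q s -> r q' s -> r q' s' -> r q s'.

Lemma edge_infty_plus theta p : edge theta p inftyK <-> exists i x, p = pt i true x.
Proof.
split=> [|[i [x ->]]//]; case: p => [[[i []] x]|] // _.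
by exists i, x.
Qed.

Lemma edge_infty_minus theta p : edge theta inftyK p <-> exists i x, p = pt i false x.
Proof.
split=> [|[i [x ->]]//]; case: p => [[[i []] x]|] // _.
by exists i, x.
Qed.

Lemma edge_minus_plus theta i j x y :
  edge theta (pt i false x) (pt j true y) <-> i = j /\ x (theta i) = y (theta i).
Proof.
by rewrite /=; case: eqVneq => [<-|/eqP ij]; split => // -[].
Qed.

Lemma edge_fibre theta i s x y : edge theta (pt i s x) (pt i s y) <-> prec x y.
Proof. by rewrite /= !eqxx. Qed.

(** The vertices beaten by infinity are those of the copies i-, and each of them
    beats exactly the points of i+ with the same bit at [theta i]. *)
Lemma cycles_complete_infty theta : cycles_complete (edge theta) inftyK.
Proof.
move=> q q' s s' /edge_infty_minus[i [x ->]] /edge_infty_minus[i' [x' ->]].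
move=> /edge_infty_plus[j [y ->]] /edge_infty_plus[j' [y' ->]].
rewrite !edge_minus_plus => -[ij xy] [i'j xy'] [i'j' xy''].
by subst i i' j'; rewrite xy -xy'.
Qed.

(** At a 2-adic point the graph contains, by [prec_between], a path through the
    levels 0, 1, 2, 3, but no edge between the levels 0 and 3. *)
Lemma cycles_complete_eq_infty theta p :
  cycles_complete (edge theta) p -> p = inftyK.
Proof.
case: p => [[[i s] x]|//] cc; exfalso.
have [q xq dq] := prec_out_exists x 0; have [q' xq' dq'] := prec_out_exists x 2.
have [r rx dr] := prec_in_exists x 1; have [r' rx' dr'] := prec_in_exists x 3.
have := cc (pt i s q) (pt i s q') (pt i s r) (pt i s r').
rewrite !edge_fibre (prec_between xq rx dq dr)// (prec_between xq' rx dq' dr)//.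
rewrite (prec_between xq' rx' dq' dr')// (prec_between xq rx' dq dr')//.
by move=> /(_ xq xq' rx rx'); case; auto.
Qed.

Definition index (p : K) : nat := if p is Some ((i, _), _) then i else 0.

Lemma out_infty_lexL1 theta : lexL1 [set p | edge theta inftyK p] (edge theta) index.
Proof.
split=> [n|p q /edge_infty_minus[i [x ->]] /edge_infty_minus[j [y ->]]].
  by exists (pt n false (flip (fun=> false) 0)).
by move=> /= /eqP/negPf ->.
Qed.

Definition fibre_first_diff (x : Z2adic) (p : K) : nat :=
  if p is Some (_, y) then first_diff x y else 0.

Lemma out_fibre_lexL1 theta i s x :
  lexL1 [set p | exists2 y, p = pt i s y & prec x y] (edge theta)
    (fibre_first_diff x).
Proof.
have [lev_surj levE] := prec_lexL1 x; split=> [n|p q [y -> xy] [z -> xz] yz].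
  by have [y xy xyn] := lev_surj n; exists (pt i s y) => //; exists y.
by rewrite edge_fibre; exact: levE.
Qed.

Section edge_isomorphism.
Variables (theta theta' : nat -> nat) (h g : K -> K).
Hypotheses (hK : cancel h g) (gK : cancel g h).
Hypothesis h_edge : forall p q, edge theta p q <-> edge theta' (h p) (h q).

Lemma iso_infty : h inftyK = inftyK.
Proof.
apply: (@cycles_complete_eq_infty theta') => q q' s s'.
rewrite -(gK q) -(gK q') -(gK s) -(gK s') -!h_edge.
exact: cycles_complete_infty.
Qed.

Lemma iso_minus_fibre i x : exists y, h (pt i false x) = pt i false y.
Proof.
have infty_h p : edge theta inftyK p <-> edge theta' inftyK (h p).
  by rewrite h_edge iso_infty.
have : edge theta' inftyK (h (pt i false x)) by rewrite -infty_h.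
move=> /edge_infty_minus[j [y hE]]; exists y; rewrite hE; congr pt.
have <- : index (h (pt i false x)) = j by rewrite hE.
rewrite (@lexL1_rigid _ _ _ _ _ _ _ _ h g (out_infty_lexL1 theta)
  (out_infty_lexL1 theta'))//.
- by move=> p /= /infty_h.
- by move=> p /= op; split=> //; apply/infty_h; rewrite gK.
Qed.

End edge_isomorphism.

Section edge_isomorphism_differ.
Variables (theta theta' : nat -> nat) (h g : K -> K).
Hypotheses (hK : cancel h g) (gK : cancel g h).
Hypothesis h_edge : forall p q, edge theta p q <-> edge theta' (h p) (h q).

Lemma inv_edge p q : edge theta' p q <-> edge theta (g p) (g q).
Proof. by rewrite h_edge !gK. Qed.

(** An instance of [lexL1_rigid] for the vertices beaten by [x] in its copy. *)
Lemma iso_differ_at i x y x' y' n :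
  h (pt i false x) = pt i false x' -> h (pt i false y) = pt i false y' ->
  differ_at x y n -> differ_at x' y' n.
Proof.
move=> hx hy xyn; wlog xy : x y x' y' hx hy xyn / prec x y.
  move=> wl; have [|yx] := prec_total (differ_at_neq xyn); first exact: wl xyn.
  by apply: differ_at_sym; apply: wl (differ_at_sym xyn) yx.
have xy' : prec x' y'.
  by apply/(edge_fibre theta' i false); rewrite -hx -hy -h_edge edge_fibre.
have [m xym _] := xy'.
suff <- : m = n by [].
rewrite -(first_diffE xym) -(first_diffE xyn).
rewrite -[first_diff x' y']/(fibre_first_diff x' (pt i false y')) -hy.
rewrite (@lexL1_rigid _ _ _ _ _ _ _ _ h g (out_fibre_lexL1 theta i false x)
  (out_fibre_lexL1 theta' i false x'))//.
- move=> p /= [z -> xz]; split => //.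
  have [z' hz] := iso_minus_fibre hK gK h_edge i z; exists z' => //.
  by apply/(edge_fibre theta' i false); rewrite -hx -hz -h_edge edge_fibre.
- move=> p /= [z -> xz]; split => //.
  have [z' gz] := iso_minus_fibre gK hK inv_edge i z; exists z' => //.
  by apply/(edge_fibre theta i false); rewrite h_edge hx -gz gK edge_fibre.
- by exists y.
Qed.

(** The vertex (i+, x') beats infinity and is beaten by both images, so its
    preimage beats infinity and is beaten by both given points. *)
Lemma iso_same_bit i x y x' y' :
  h (pt i false x) = pt i false x' -> h (pt i false y) = pt i false y' ->
  x' (theta' i) = y' (theta' i) -> x (theta i) = y (theta i).
Proof.
move=> hx hy xy'.
have infty_h p : edge theta p inftyK <-> edge theta' (h p) inftyK.
  by rewrite h_edge (iso_infty gK h_edge).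
have : edge theta (g (pt i true x')) inftyK by rewrite infty_h gK.
move=> /edge_infty_plus[j [z gz]].
have : edge theta (pt i false x) (pt j true z).
  by rewrite -gz h_edge gK hx edge_minus_plus.
have : edge theta (pt i false y) (pt j true z).
  by rewrite -gz h_edge gK hy edge_minus_plus.
by rewrite !edge_minus_plus => -[ij ->] [_ ->].
Qed.

Lemma iso_theta_le i : theta i <= theta' i.
Proof.
rewrite leqNgt; apply/negP => lt.
pose x : Z2adic := fun=> false; pose y := flip x (theta i).
have [x' hx] := iso_minus_fibre hK gK h_edge i x.
have [y' hy] := iso_minus_fibre hK gK h_edge i y.
have xyn := differ_at_flip x (theta i).
have [low _] := iso_differ_at hx hy xyn.
by have [_] := xyn; apply; exact: iso_same_bit hx hy (low _ lt).
Qed.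

End edge_isomorphism_differ.

Lemma T_iso_inj theta theta' : isomorphic (T_ theta) (T_ theta') -> theta = theta'.
Proof.
move=> [h [[_ h_surj hT] h_inj]].
have ex q : exists p, h p = q.
  by have [p _ <-] : range h q; [rewrite h_surj|exists p].
pose g q := sval (cid (ex q)).
have gK : cancel g h by move=> q; rewrite /g; case: cid.
have hK : cancel h g by move=> p; apply: h_inj; rewrite gK.
have h_edge1 p q : edge theta p q -> edge theta' (h p) (h q).
  move=> pq; have : T_ theta' (h p, h q).
    by apply: hT; exists (p, q) => //; apply/T_E; right.
  by move=> /T_E[/h_inj pq'|//]; move: pq; rewrite pq' => /edge_irr.
have h_edge p q : edge theta p q <-> edge theta' (h p) (h q).
  split=> [/h_edge1//|pq'].
  have [pq|/eqP pq] := eqVneq p q; first by move: pq'; rewrite pq => /edge_irr.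
  have [//|/h_edge1 qp'] := edge_total theta pq.
  by have := edge_asym pq' qp'.
apply/funext => i; apply/eqP; rewrite eqn_leq (iso_theta_le hK gK h_edge).
by rewrite (iso_theta_le gK hK (inv_edge gK h_edge)).
Qed.

(** * Topology *)

Lemma nbhs_cylinder (x : Z2adic) n :
  nbhs x [set y : Z2adic | forall k, k < n -> y k = x k].
Proof.
have bit k : nbhs x [set y : Z2adic | y k = x k].
  have := @proj_continuous _ (fun=> bool) k x [set x k].
  by apply; exact: (@discrete_set1 bool).
elim: n => [|n IH]; first by apply: filterS filterT.
apply: filterS (filterI IH (bit n)) => y [/= yx yn] k.
by rewrite ltnS leq_eqVlt => /orP[/eqP ->|/yx].
Qed.

Lemma nbhs_pt i s x (U : set Z2adic) :
  nbhs x U -> nbhs (pt i s x) [set p | exists2 y, U y & p = pt i s y].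
Proof.
move=> xU.
exists ([set ((i, s) : signed_nat)], U) => /=; first by split.
by move=> [a y] /= [-> Uy]; exists y.
Qed.

(** The copies of index less than n form a closed compact set. *)
Lemma nbhs_infty n :
  nbhs inftyK [set p | if p is Some _ then n <= index p else True].
Proof.
exists ([set a : signed_nat | a.1 < n] `*` [set: Z2adic]).
  split.
    apply: compact_setX; last exact: cantor_space_compact.
    apply: finite_compact.
    apply: (@sub_finite_set _ _ (`I_n `*` [set: bool])).
      by move=> [i s].
    by apply: finite_setX; [exact: finite_II|exact: finite_finset].
  have -> : [set a : signed_nat | a.1 < n] `*` [set: Z2adic] =
      fst @^-1` [set a : signed_nat | a.1 < n].
    by rewrite eqEsubset; split=> a; [case|].
  have /continuous_closedP : continuous (fst : signed_nat * Z2adic -> signed_nat).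
    by move=> a; exact: cvg_fst.
  by apply; exact: discrete_closed.
by move=> p [[[[i s] x] /= + <-]|->//] /=; case: leqP => // _; case.
Qed.

(** Inside a copy the direction is decided by finitely many bits, between
    opposite copies by one bit and between other copies by the copies alone; at
    infinity all copies of index greater than i+1 behave alike towards i+ and
    i-. *)
Lemma edge_open theta p q : edge theta p q ->
  exists U V, [/\ nbhs p U, nbhs q V & forall u v, U u -> V v -> edge theta u v].
Proof.
case: p => [[[i s] x]|]; case: q => [[[j t] y]|] //=; last first.
- case: t => // _.
  exists [set p | if p is Some _ then j.+2 <= index p else True],
         [set p | exists2 z, setT z & p = pt j false z].
  split; [exact: nbhs_infty|by apply: nbhs_pt; exact: filterT|].
  move=> [[[i s] x]|] _ /= + [z _ ->] => //= ij.
  rewrite (_ : i == j = false); last by apply/eqP; lia.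
  by case: s => //; rewrite /L1; lia.
- case: s => // _.
  exists [set p | exists2 z, setT z & p = pt i true z],
         [set p | if p is Some _ then i.+2 <= index p else True].
  split; [by apply: nbhs_pt; exact: filterT|exact: nbhs_infty|].
  move=> _ [[[j t] y]|] [z _ ->] //= ij.
  rewrite (_ : i == j = false); last by apply/eqP; lia.
  by case: t => //; rewrite /L1; lia.
pose fib i s x n :=
  [set p | exists2 z : Z2adic, (forall k, k < n -> z k = x k) & p = pt i s z].
have fibP i' s' x' n : nbhs (pt i' s' x') (fib i' s' x' n).
  by apply: nbhs_pt; exact: nbhs_cylinder.
case: eqVneq => [<-|ij] e; last first.
  exists (fib i s x 0), (fib j t y 0); split; [exact: fibP|exact: fibP|].
  by move=> _ _ [x' _ ->] [y' _ ->] /=; rewrite (negPf ij).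
move: e; case: eqVneq => [<-|st] e; last first.
  exists (fib i s x (theta i).+1), (fib i t y (theta i).+1).
  split; [exact: fibP|exact: fibP|].
  by move=> _ _ [x' xx ->] [y' yy ->] /=; rewrite eqxx (negPf st) xx// yy.
have [n [xyl xyn] E] := e.
exists (fib i s x n.+2), (fib i s y n.+2); split; [exact: fibP|exact: fibP|].
move=> _ _ [x' xx ->] [y' yy ->] /=; rewrite !eqxx.
exists n; last by rewrite !xx// yy.
split=> [k kn|]; last by rewrite xx// yy.
have k2 : k < n.+2 by rewrite ltnS ltnW// ltnW.
by rewrite xx// yy// xyl.
Qed.

Lemma T_closed theta : closed (T_ theta).
Proof.
rewrite -[T_ theta]setCK closedC openE => -[p q] /= npq.
have /edge_open[U [V [qU pV UV]]] : edge theta q p.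
  have pq : p <> q by move=> pq; apply: npq; apply/T_E; left.
  by have [pq'|//] := edge_total theta pq; case: npq; apply/T_E; right.
exists (V, U) => // -[a b] /= [Va Ub] /T_E[ab|ab].
  by have := UV _ _ Ub Va; rewrite ab => /edge_irr.
exact: edge_asym ab (UV _ _ Ub Va).
Qed.

Lemma K_compact : compact [set: K].
Proof. exact: one_point_compactification_compact. Qed.

(** The copies are listed in the order 0-, 0+, 1-, 1+, ... *)
Definition cantor_code (p : K) : cantor_space :=
  match p with
  | Some ((i, s), x) => fun n =>
      if n < i.*2 + s then false
      else if n == i.*2 + s then true else x (n - (i.*2 + s).+1)
  | None => fun=> false
  end.

Lemma cantor_codeE i (s : bool) x :
  [/\ forall k, k < i.*2 + s -> cantor_code (pt i s x) k = false,
      cantor_code (pt i s x) (i.*2 + s) = true &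
      forall k, cantor_code (pt i s x) ((i.*2 + s).+1 + k) = x k].
Proof.
rewrite /=; set n := i.*2 + s; split=> [k ->//||k].
  by rewrite ltnn eqxx.
have -> : n.+1 + k < n = false.
  by apply/negbTE; rewrite -leqNgt addSn ltnW// ltnS leq_addr.
have -> : n.+1 + k == n = false.
  by apply/negbTE; rewrite gtn_eqF// addSn ltnS leq_addr.
by rewrite addKn.
Qed.

Lemma cantor_code_inj : injective cantor_code.
Proof.
move=> [[[i s] x]|] [[[j t] y]|] // pq.
- have [xl xn xh] := cantor_codeE i s x; have [yl yn yh] := cantor_codeE j t y.
  rewrite -[cantor_code (pt i s x)]/(cantor_code (Some (i, s, x))) pq in xl xn xh.
  have ijst : i.*2 + s = j.*2 + t.
    have [ij|ji|//] := ltngtP (i.*2 + s) (j.*2 + t).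
      by rewrite yl in xn.
    by rewrite xl in yn.
  have ij : i = j by move: ijst; case: (s); case: (t); lia.
  have st : s = t by move: ijst; rewrite ij => /addnI; case: (s); case: (t).
  subst j t; suff -> : x = y by [].
  by apply/funext => k; rewrite -xh yh.
- have [_ + _] := cantor_codeE i s x.
  by rewrite -[cantor_code (pt i s x)]/(cantor_code (Some (i, s, x))) pq.
- have [_ + _] := cantor_codeE j t y.
  by rewrite -[cantor_code (pt j t y)]/(cantor_code (Some (j, t, y))) -pq.
Qed.

Lemma cantor_code_surj y : exists p, cantor_code p = y.
Proof.
have [ex|nex] := pselect (exists n, y n); last first.
  exists inftyK; apply/funext => n /=; apply/esym/negbTE/negP => yn.
  by apply: nex; exists n.
have [n yn n_min] := ex_minnP ex.
have nE : n = (n./2).*2 + odd n by rewrite addnC odd_double_half.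
exists (pt n./2 (odd n) (fun k => y (n.+1 + k))).
have [cl cn ch] := cantor_codeE n./2 (odd n) (fun k => y (n.+1 + k)).
rewrite -nE in cl cn ch.
apply/funext => k; have [kn|nk|->] := ltngtP k n; last by rewrite cn yn.
  by rewrite cl//; apply/esym/negbTE/negP => /n_min; rewrite leqNgt kn.
by rewrite -(subnKC nk) ch.
Qed.

Lemma continuous_cantor_space (X : topologicalType) (f : X -> cantor_space) :
  (forall p n, nbhs p [set q | f q n = f p n]) -> continuous f.
Proof.
move=> floc p; apply/cvg_sup => n A [B [[C oC <-] Cfp] BA].
apply: filterS (floc p n) => q /= fq; apply: BA => /=.
by rewrite /= /proj fq.
Qed.

Lemma cantor_code_continuous : continuous cantor_code.
Proof.
apply: continuous_cantor_space => -[[[i s] x]|] n.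
  have /(nbhs_pt i s) := nbhs_cylinder x n.
  apply: filterS => _ [y yx ->] /=; case: ltnP => // le; case: eqVneq => // ni.
  by rewrite yx//; lia.
have := nbhs_infty n.+1.
apply: filterS => -[[[i s] x] /= ni|//].
by rewrite (leq_trans ni)// -addnn -addnA leq_addr.
Qed.

(** The code is a continuous bijection from a compact space to a Hausdorff
    space. *)
Lemma K_cantor_set : cantor_set K.
Proof.
pose g y := sval (cid (cantor_code_surj y)).
have gK : cancel g cantor_code by move=> y; rewrite /g; case: cid.
have codeK : cancel cantor_code g by move=> p; apply: cantor_code_inj; rewrite gK.
exists g, cantor_code; split => //; last exact: cantor_code_continuous.
apply/continuous_closedP => A clA.
have -> : g @^-1` A = cantor_code @` A.
  rewrite eqEsubset; split=> [y /= Ay|_ [p Ap <-] /=]; last by rewrite codeK.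
  by exists (g y).
apply: (compact_closed cantor_space_hausdorff).
apply: continuous_compact.
  by apply: continuous_subspaceT => p; exact: cantor_code_continuous.
exact: subclosed_compact clA K_compact _.
Qed.

Theorem theorem13p8 :
  (forall theta : nat -> nat,
      topological_tournament (T_ theta) /\ arc_cyclic (T_ theta) /\
      prime_tournament (T_ theta) /\ cantor_set K) /\
  (forall theta theta' : nat -> nat,
      theta <> theta' -> ~ isomorphic (T_ theta) (T_ theta')).
Proof.
split=> [theta|theta theta' + /T_iso_inj]; last exact.
have Ttop : topological_tournament (T_ theta).
  by split; [exact: T_tournament|exact: T_closed].
split; first exact: Ttop.
split; first exact: T_arc_cyclic.
split; last exact: K_cantor_set.
split; first by split; [exact: Ttop|exact: K_compact].
  by exists inftyK, (pt 0 true 0%R).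
by move=> Y S h [[ST _] _]; exact: T_quotient_iso.
Qed.
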